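(* Let $n\in\mathbb N$ and let $1=\{0\}$ be the linear order with a single element. The orders $T_n$ and $T_n[0]$ of van der Meeren, Rathjen and Weiermann coincide with the orders $\mathsf T_n(1)$ and $\mathsf T^0_n(1)$, respectively, when the term $\overline 0\in\mathsf T_n(1)$ is identified with the term $0\in T_n$.
   Context: Given a linear order $X$, a set $\mathsf T(X)$ of terms and a function $S:\mathsf T(X)\to\mathbb N\cup\{-1\}$ are generated by simultaneous recursion: (i) for each $x\in X$ there is a term $\overline x\in\mathsf T(X)$ with $S(\overline x)=-1$; (ii) given $s\in\mathsf T(X)$ and $i\in\mathbb N$ with $i\geq\max\{S(s)-1,0\}$, there is a term $\vartheta_is\in\mathsf T(X)$ with $S(\vartheta_is)=i$. For $i\in\mathbb N\cup\{-1\}$ define $k_i:\mathsf T(X)\to\mathsf T(X)$ by $k_i(\overline x)=\overline x$, $k_i(\vartheta_js)=\vartheta_js$ if $j\leq i$, and $k_i(\vartheta_js)=k_i(s)$ if $j>i$. The relation $s<_{\mathsf T(X)}t$ holds if and only if one of the following applies: (i') $s=\overline x$, $t=\overline y$ and $x<_Xy$; (ii') $s$ is of the form $\overline x$ and $t$ of the form $\vartheta_jt'$; (iii') $s=\vartheta_is'$, $t=\vartheta_jt'$ and one of the following holds: $i<j$; or $i=j$, $s'<_{\mathsf T(X)}t'$ and $k_i(s')<_{\mathsf T(X)}t$; or $i=j$ and $s\leq_{\mathsf T(X)}k_j(t')$ (where $\leq_{\mathsf T(X)}$ means $<_{\mathsf T(X)}$ or equality of terms). This is a linear order. The suborder $\mathsf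 T_n(X)\subseteq\mathsf T(X)$ consists of the terms that contain only indices $i<n$, and $\mathsf T^0_n(X)=\{s\in\mathsf T_n(X)\mid S(s)\leq 0\}$. The system $T_n$: its terms, the function $S$ and the functions $k_i$ are generated in the same way from a single constant $0$ with $S(0)=-1$ and $k_i(0)=0$, namely $\vartheta_is\in T_n$ with $S(\vartheta_is)=i$ whenever $s\in T_n$, $i<n$ and $i\geq\max\{S(s)-1,0\}$. Its order $<$ is given recursively by the following clauses: $0<\vartheta_jt$; $\vartheta_is<\vartheta_jt$ if $i<j$; $\vartheta_is<\vartheta_it$ if $s<t$ and $k_i(s)<\vartheta_it$; $\vartheta_is<\vartheta_it$ if $s>t$ and $\vartheta_is\leq k_i(t)$ (where $\leq$ means $<$ or equality of terms); no other inequalities hold. $T_n[0]$ is the suborder of terms $s\in T_n$ with $S(s)\leq 0$. *)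

(* Defs.v *)
From mathcomp Require Import all_boot all_order all_algebra.

Set Implicit Arguments.
Unset Strict Implicit.
Unset Printing Implicit Defensive.

(* The set N \cup {-1} is rendered inside int: S only takes values >= -1, and
   k_i is only meant for i >= -1.  The simultaneous recursion generating terms
   together with S is split into raw terms, on which S, k_i and < are defined
   clause by clause, and a well-formedness predicate.  Subterms of
   well-formed terms and hence values of k_i on them are well-formed, so the
   relations below restrict to the intended ones. *)

Inductive pterm (X : Type) : Type :=
| Bar of X
| Theta of nat & pterm X.

Arguments Bar {X} x.
Arguments Theta {X} i s.

Definition tS (X : Type) (s : pterm X) : int :=
  match s with
  | Bar _ => (-1)%R
  | Theta i _ => i%:Z
  end.

Fixpoint is_term (X : Type) (s : pterm X) : bool :=
  match s with
  | Bar _ => true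
  | Theta i s' => is_term s' && (Num.max (tS s' - 1) 0 <= i%:Z)%R
  end.

Fixpoint tk (X : Type) (i : int) (s : pterm X) : pterm X :=
  match s with
  | Bar x => Bar x
  | Theta j s' => if (j%:Z <= i)%R then Theta j s' else tk i s'
  end.

(* All recursive occurrences are positive and compare pairs of smaller total
   length, so the least relation closed under the clauses is the only relation
   that holds if and only if one of the clauses applies. *)
Inductive tlt (d : Order.disp_t) (X : orderType d) :
  pterm X -> pterm X -> Prop :=
| tlt_bar x y : (x < y)%O -> tlt (Bar x) (Bar y)
| tlt_bar_theta x j t : tlt (Bar x) (Theta j t)
| tlt_index i j s t : i < j -> tlt (Theta i s) (Theta j t)
| tlt_arg i s t :
    tlt s t -> tlt (tk i%:Z s) (Theta i t) -> tlt (Theta i s) (Theta i t)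
| tlt_k i s t :
    tlt (Theta i s) (tk i%:Z t) \/ Theta i s = tk i%:Z t ->
    tlt (Theta i s) (Theta i t).

Fixpoint indices_lt (X : Type) (n : nat) (s : pterm X) : bool :=
  match s with
  | Bar _ => true
  | Theta i s' => (i < n) && indices_lt n s'
  end.

Definition Tn (n : nat) (X : Type) : Type :=
  {s : pterm X | is_term s && indices_lt n s}.

Definition T0n (n : nat) (X : Type) : Type :=
  {s : pterm X | [&& is_term s, indices_lt n s & (tS s <= 0)%R]}.

(* The system T_n of van der Meeren, Rathjen and Weiermann, with its own
   recursion and order clauses.  The last clause of vlt has the premise s > t
   that tlt_k lacks. *)

Inductive vterm : Type :=
| VZero
| VTheta of nat & vterm.

Definition vS (s : vterm) : int :=
  match s with
  | VZero => (-1)%R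
  | VTheta i _ => i%:Z
  end.

Fixpoint is_vterm (n : nat) (s : vterm) : bool :=
  match s with
  | VZero => true
  | VTheta i s' =>
      [&& is_vterm n s', i < n & (Num.max (vS s' - 1) 0 <= i%:Z)%R]
  end.

Fixpoint vk (i : int) (s : vterm) : vterm :=
  match s with
  | VZero => VZero
  | VTheta j s' => if (j%:Z <= i)%R then VTheta j s' else vk i s'
  end.

Inductive vlt : vterm -> vterm -> Prop :=
| vlt_zero j t : vlt VZero (VTheta j t)
| vlt_index i j s t : i < j -> vlt (VTheta i s) (VTheta j t)
| vlt_arg i s t :
    vlt s t -> vlt (vk i%:Z s) (VTheta i t) -> vlt (VTheta i s) (VTheta i t)
| vlt_k i s t :
    vlt t s -> vlt (VTheta i s) (vk i%:Z t) \/ VTheta i s = vk i%:Z t ->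
    vlt (VTheta i s) (VTheta i t).

Definition VTn (n : nat) : Type := {s : vterm | is_vterm n s}.

Definition VTn0 (n : nat) : Type :=
  {s : vterm | is_vterm n s && (vS s <= 0)%R}.

(* 'I_1 with its canonical order is the linear order 1 = {0}. *)

Fixpoint identify (s : vterm) : pterm 'I_1 :=
  match s with
  | VZero => Bar ord0
  | VTheta i s' => Theta i (identify s')
  end.

(* Main.v *)
(** The premise [s > t] in the last clause of the order on [T_n] is harmless.
    The order on T(X) is linear, and [k_i s < theta_i s] always holds: [k_i s]
    is a constant, or has index [j < i], or has index [i], and then it is
    smaller by the clause [theta_i r <= k_i s] with [theta_i r = k_i s].
    Now suppose [theta_i s <= k_i t].  If [s < t], then
    [k_i s < theta_i s <= k_i t < theta_i t], so the clause comparing arguments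
    already yields [theta_i s < theta_i t].  And [s = t] is impossible, since
    it would give [theta_i s <= k_i s < theta_i s].  None of this uses the
    conditions on indices, so it is done for raw terms. *)

Require Import Defs.
From mathcomp Require Import all_boot all_order all_algebra.
From mathcomp Require Import zify.

Set Implicit Arguments.
Unset Strict Implicit.
Unset Printing Implicit Defensive.

(** Measure for the inductions on several terms at once: since [tk] does not increase it, replacing
    [Theta i s] by [tk i s] lowers it. *)
Fixpoint tsize (X : Type) (s : pterm X) : nat :=
  if s is Theta _ s' then (tsize s').+1 else 0.

Lemma tsize_tk (X : Type) i (s : pterm X) : tsize (tk i s) <= tsize s.
Proof. by elim: s => //= j s IHs; case: ifP => //= _; apply: leqW. Qed.

Section TermOrder.
Context {d : Order.disp_t} {X : orderType d}.
Implicit Types (r s t : pterm X) (i j : nat).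

Definition tle s t := tlt s t \/ s = t.

Lemma tlt_BarE (x y : X) : tlt (Bar x) (Bar y) <-> (x < y)%O.
Proof. by split=> [H|]; [inversion H | apply: tlt_bar]. Qed.

Lemma not_tlt_Theta_Bar i s (x : X) : ~ tlt (Theta i s) (Bar x).
Proof. by move=> H; inversion H. Qed.

Lemma tlt_ThetaP i j s t : tlt (Theta i s) (Theta j t) ->
  i < j \/ i = j /\
    (tlt s t /\ tlt (tk i%:Z s) (Theta i t) \/ tle (Theta i s) (tk i%:Z t)).
Proof. by rewrite ?/tle => H; inversion H; subst; tauto. Qed.

Lemma tk_lt_Theta i s : tlt (tk i%:Z s) (Theta i s).
Proof.
(* The right-hand term is decoupled from [s], keeping only the common value of [tk]: the induction
   descends into [s] while [t] stays fixed. *)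
suff: forall t, tk i%:Z s = tk i%:Z t -> tlt (tk i%:Z s) (Theta i t) by exact.
elim: s => [x|j s IHs] t /=; first by move=> _; apply: tlt_bar_theta.
case: ifP => [le_ji|_]; last exact: IHs.
case: (ltngtP j i) => [lt_ji _|lt_ij|eq_ji]; first exact: tlt_index.
  lia.
by subst j => eq_k; apply: tlt_k; right.
Qed.

Lemma tlt_trans s r t : tlt r s -> tlt s t -> tlt r t.
Proof.
have [m] := ubnP (tsize r + tsize s + tsize t).
elim: m r s t => // m IHm [x|i r] [y|j s] [z|k t] /= szm.
- by rewrite !tlt_BarE; apply: Order.POrderTheory.lt_trans.
- by move=> _ _; apply: tlt_bar_theta.
- by move=> _ /not_tlt_Theta_Bar.
- by move=> _ _; apply: tlt_bar_theta.
- by move=> /not_tlt_Theta_Bar.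
- by move=> /not_tlt_Theta_Bar.
- by move=> _ /not_tlt_Theta_Bar.
move=> lt_rs lt_st.
case/tlt_ThetaP: (lt_rs) => [lt_ij|[eq_ij rs]];
  case/tlt_ThetaP: (lt_st) => [lt_jk|[eq_jk st]]; subst;
  try by apply: tlt_index; lia.
have szr := tsize_tk k%:Z r; have szs := tsize_tk k%:Z s.
have szt := tsize_tk k%:Z t.
(* If [Theta k s <= tk k t], then [Theta k r] is below [tk k t] too. Otherwise [s < t] and
   [tk k s < Theta k t], and either reason for [Theta k r < Theta k s] leads to smaller triples. *)
case: st => [[lt_st' lt_kst]|[lt_skt|eq_skt]];
  last by apply: tlt_k; left; rewrite -eq_skt.
  case: rs => [[lt_rs' lt_krs]|[lt_rks|->]] //.
    apply: tlt_arg; first by apply: IHm lt_rs' lt_st'; lia.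
    by apply: IHm lt_krs lt_st => /=; lia.
  by apply: IHm lt_rks lt_kst => /=; lia.
by apply: tlt_k; left; apply: IHm lt_rs lt_skt => /=; lia.
Qed.

Lemma tle_lt_trans s r t : tle r s -> tlt s t -> tlt r t.
Proof. by case=> [|-> //]; apply: tlt_trans. Qed.

(** A loop at [Theta i s] yields one at a smaller term: at [s], or, by transitivity and
    [tk_lt_Theta], at [tk i s]. *)
Lemma tlt_irr s : ~ tlt s s.
Proof.
have [m] := ubnP (tsize s); elim: m s => // m IHm [x|i s] /= szm.
  by rewrite tlt_BarE Order.POrderTheory.ltxx.
case/tlt_ThetaP => [|[_ [[lt_ss _]|le_sk]]]; first by rewrite ltnn.
  by apply: IHm lt_ss.
have szk := tsize_tk i%:Z s.
case: le_sk => [lt_sk|eq_sk]; last by rewrite -eq_sk /= ltnn in szk.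
by apply: IHm (tlt_trans (tk_lt_Theta i s) lt_sk); lia.
Qed.

Lemma tlt_total s t : [\/ tlt s t, s = t | tlt t s].
Proof.
have [m] := ubnP (tsize s + tsize t).
elim: m s t => // m IHm [x|i s] [y|j t] /= szm.
- have [lt_xy|lt_yx|->] := Order.TotalTheory.ltgtP x y; last exact: Or32.
    by apply: Or31; apply: tlt_bar.
  by apply: Or33; apply: tlt_bar.
- by apply: Or31; apply: tlt_bar_theta.
- by apply: Or33; apply: tlt_bar_theta.
have [lt_ij|lt_ji|eq_ij] := ltngtP i j.
- by apply: Or31; apply: tlt_index.
- by apply: Or33; apply: tlt_index.
subst j.
have szs := tsize_tk i%:Z s; have szt := tsize_tk i%:Z t.
have [|lt_st|->|lt_ts] := IHm s t; [lia| |exact: Or32|].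
(* For [s < t], the position of [tk i s] relative to [Theta i t] decides: below it, [tlt_arg]
   applies; otherwise [tlt_k] gives the reverse inequality. *)
- have [|lt_kst|eq_kst|lt_tks] := IHm (tk i%:Z s) (Theta i t);
    first by move=> /=; lia.
  + by apply: Or31; apply: tlt_arg.
  + by apply: Or33; apply: tlt_k; right.
  + by apply: Or33; apply: tlt_k; left.
have [|lt_kts|eq_kts|lt_skt] := IHm (tk i%:Z t) (Theta i s);
  first by move=> /=; lia.
- by apply: Or33; apply: tlt_arg.
- by apply: Or31; apply: tlt_k; right.
- by apply: Or31; apply: tlt_k; left.
Qed.

(** Reconciles the last clauses of the two orders: the outcome is either the premises of [tlt_arg]
    or the additional premise of [vlt_k]. *)
Lemma Theta_le_tk i s t : tle (Theta i s) (tk i%:Z t) ->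
  tlt s t /\ tlt (tk i%:Z s) (Theta i t) \/ tlt t s.
Proof.
move=> le_skt; have [lt_st|eq_st|] := tlt_total s t; last by right.
  left; split=> //; apply: tlt_trans (tk_lt_Theta i s) _.
  exact: tle_lt_trans le_skt (tk_lt_Theta i t).
subst t; case: (@tlt_irr (Theta i s)).
exact: tle_lt_trans le_skt (tk_lt_Theta i s).
Qed.

End TermOrder.

Fixpoint unidentify (s : pterm 'I_1) : vterm :=
  if s is Theta i s' then VTheta i (unidentify s') else VZero.

Lemma identifyK : cancel identify unidentify.
Proof. by elim=> //= i s ->. Qed.

Lemma unidentifyK : cancel unidentify identify.
Proof. by elim=> [x|i s] /= => [|->] //; rewrite [x]ord1. Qed.

Lemma tS_identify s : tS (identify s) = vS s.
Proof. by case: s. Qed.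

Lemma identify_vk i s : identify (vk i s) = tk i (identify s).
Proof. by elim: s => //= j s IHs; case: ifP. Qed.

Lemma is_term_identify n s :
  is_term (identify s) && indices_lt n (identify s) = is_vterm n s.
Proof.
elim: s => //= i s <-; rewrite tS_identify.
by rewrite -!andbA; do !bool_congr; rewrite andbC.
Qed.

Lemma vlt_ThetaP i j s t : vlt (VTheta i s) (VTheta j t) ->
  i < j \/ i = j /\
    (vlt s t /\ vlt (vk i%:Z s) (VTheta i t) \/
     (vlt (VTheta i s) (vk i%:Z t) \/ VTheta i s = vk i%:Z t)).
Proof. by rewrite ?/tle => H; inversion H; subst; tauto. Qed.

Lemma tlt_identify s t : vlt s t -> tlt (identify s) (identify t).
Proof.
have [m] := ubnP (tsize (identify s) + tsize (identify t)).
elim: m s t => // m IHm [|i s] [|j t] /= szm; try by move=> H; inversion H.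
  by move=> _; apply: tlt_bar_theta.
have szs := tsize_tk i%:Z (identify s).
have szt := tsize_tk i%:Z (identify t).
case/vlt_ThetaP => [|[eq_ij]]; first exact: tlt_index.
subst j; case=> [[lt_st lt_kst]|le_skt].
  apply: tlt_arg; first by apply: IHm lt_st; lia.
  rewrite -identify_vk; apply: (IHm _ (VTheta i t)) lt_kst.
  by rewrite identify_vk /=; lia.
apply: tlt_k; rewrite -identify_vk; case: le_skt => [lt_skt|<-]; last by right.
by left; apply: (IHm (VTheta i s)) lt_skt; rewrite identify_vk /=; lia.
Qed.

(** The induction is on size and not on derivations: the inequality [t < s] required by [vlt_k]
    comes from linearity and need not occur in the given derivation. *)
Lemma vlt_identify s t : tlt (identify s) (identify t) -> vlt s t.
Proof.
have [m] := ubnP (tsize (identify s) + tsize (identify t)).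
elim: m s t => // m IHm [|i s] [|j t] /= szm.
- by rewrite tlt_BarE.
- by move=> _; apply: vlt_zero.
- by move=> /not_tlt_Theta_Bar.
have szs := tsize_tk i%:Z (identify s).
have szt := tsize_tk i%:Z (identify t).
case/tlt_ThetaP => [|[eq_ij]]; first exact: vlt_index.
subst j.
(* This serves twice: for [tlt_arg] itself, and for [tlt_k] when [s < t]. *)
have arg : tlt (identify s) (identify t) /\
    tlt (tk i%:Z (identify s)) (Theta i (identify t)) ->
    vlt (VTheta i s) (VTheta i t).
  case=> lt_st lt_kst; apply: vlt_arg; first by apply: IHm lt_st; lia.
  by apply: IHm; rewrite identify_vk //=; lia.
case=> [//|le_skt]; have [//|lt_ts] := Theta_le_tk le_skt.
apply: vlt_k; first by apply: IHm lt_ts; lia.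
case: le_skt => [lt_skt|eq_skt]; [left|right].
  by apply: IHm; rewrite identify_vk //=; lia.
by apply: (can_inj identifyK); rewrite identify_vk.
Qed.

(** The inverse restricts as well, because [P (g y) = Q (f (g y)) = Q y]. As [P] and [Q] are
    boolean, elements of the subtypes are equal once their values are. *)
Lemma sub_bijection (A B : Type) (P : pred A) (Q : pred B) (f : A -> B) g :
  cancel f g -> cancel g f -> (forall x, Q (f x) = P x) ->
  exists F : {x | P x} -> {y | Q y},
    (forall x, sval (F x) = f (sval x)) /\ bijective F.
Proof.
move=> fK gK QfE.
have Qf (x : {x | P x}) : Q (f (sval x)) by rewrite QfE (valP x).
have Pg (y : {y | Q y}) : P (g (sval y)) by rewrite -QfE gK (valP y).
exists (fun x => exist _ (f (sval x)) (Qf x)); split=> //.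
exists (fun y => exist _ (g (sval y)) (Pg y)) => z; apply: val_inj.
  exact: fK.
exact: gK.
Qed.

Theorem corollary3p5 (n : nat) :
  (exists f : VTn n -> Tn n 'I_1,
     [/\ forall s : VTn n, sval (f s) = identify (sval s),
         bijective f
       & forall s t : VTn n,
           vlt (sval s) (sval t) <-> tlt (sval (f s)) (sval (f t))])
  /\
  (exists f0 : VTn0 n -> T0n n 'I_1,
     [/\ forall s : VTn0 n, sval (f0 s) = identify (sval s),
         bijective f0
       & forall s t : VTn0 n,
           vlt (sval s) (sval t) <-> tlt (sval (f0 s)) (sval (f0 t))]).
Proof.
split.
  have [f [fE f_bij]] :=
    sub_bijection (Q := fun s => is_term s && indices_lt n s)
      identifyK unidentifyK (is_term_identify n).
  exists f; split=> // s t; rewrite !fE.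
  by split; [apply: tlt_identify | apply: vlt_identify].
have T0nE s : [&& is_term (identify s), indices_lt n (identify s)
    & (tS (identify s) <= 0)%R] = is_vterm n s && (vS s <= 0)%R.
  by rewrite andbA is_term_identify tS_identify.
have [f [fE f_bij]] :=
  sub_bijection (P := fun s => is_vterm n s && (vS s <= 0)%R)
    (Q := fun s => [&& is_term s, indices_lt n s & (tS s <= 0)%R])
    identifyK unidentifyK T0nE.
exists f; split=> // s t; rewrite !fE.
by split; [apply: tlt_identify | apply: vlt_identify].
Qed.
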